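(* For any graphs $G$ and $H$ of orders $n\ge 2$ and $n'\ge 2$, respectively, $$\left\lceil\frac{nn'}{2}\right\rceil\le \gamma_{\rm sp}(G\Box H)\le n'\gamma_{\rm sp}(G)-\lambda(G)\bigl(n'-\gamma_{\rm sp}(H)\bigr).$$
   Context: All graphs are finite, simple and undirected. For a vertex $v$, $N(v)$ is its set of neighbours, and for $X\subseteq V(G)$, $N(X)=\bigcup_{x\in X}N(x)$; for $D\subseteq V(G)$, $\overline{D}=V(G)\setminus D$. A set $D\subseteq V(G)$ is a super dominating set of $G$ if for every $u\in\overline{D}$ there exists $v\in D$ such that $N(v)\cap\overline{D}=\{u\}$; the super domination number $\gamma_{\rm sp}(G)$ is the minimum cardinality of a super dominating set, and a super dominating set of that cardinality is a $\gamma_{\rm sp}(G)$-set. Let $\mathcal{S}(G)$ be the set of all $\gamma_{\rm sp}(G)$-sets. For $S\in\mathcal{S}(G)$, $\mathcal{P}(S)$ is the family of subsets $S^*\subseteq S$ with $|S^*|=|\overline{S}|$ such that for every $u\in\overline{S}$ there is $u^*\in S^*$ with $N(u^* )\cap\overline{S}=\{u\}$. Define $$\lambda(G)=\max_{S\in\mathcal{S}(G),\,S^*\in\mathcal{P}(S)}\{|X|:\ X\subseteq S\text{ and }N(X)\cap(\overline{S}\cup S^* )=\emptyset\}.$$ The Cartesian product $G\Box H$ has vertex set $V(G)\times V(H)$, with $(g,h)$ adjacent to $(g',h')$ iff either $g=g'$ and $hh'\in E(H)$, or $gg'\in E(G)$ and $h=h'$. *)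

(* Defs.v *)
From mathcomp Require Import all_boot all_order all_algebra.

Set Implicit Arguments.
Unset Strict Implicit.
Unset Printing Implicit Defensive.

(* A finite simple graph is given by a symmetric irreflexive [e : rel T] on a
   finType [T]; both properties are hypotheses where they are needed. *)

Section SuperDomination.
Variables (T : finType) (e : rel T).
Implicit Types (u v : T) (D S Ss X : {set T}).

Definition nbh v : {set T} := [set w | e v w].

Definition nbhs X : {set T} := \bigcup_(x in X) nbh x.

Definition super_dominating D : bool :=
  [forall u in ~: D, exists v in D, nbh v :&: ~: D == [set u]].

Lemma super_dominatingT : super_dominating [set: T].
Proof. by apply/forall_inP=> u; rewrite !inE. Qed.

(* The minimum ranges over a nonempty family, by [super_dominatingT]. *)
Definition gamma_sp : nat :=
  #|[arg min_(D < [set: T] | super_dominating D) #|D|]|.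

Definition gamma_sp_set S : bool :=
  super_dominating S && (#|S| == gamma_sp).

(* [Ss] belongs to the family P(S). *)
Definition private_family S Ss : bool :=
  [&& Ss \subset S, #|Ss| == #|~: S| &
      [forall u in ~: S, exists v in Ss, nbh v :&: ~: S == [set u]]].

(* The value 0 that [\max] takes on an empty range plays no role: a
   [gamma_sp_set] S exists, each such S has a [private_family], and X = set0
   is always admissible. *)
Definition lambda : nat :=
  \max_(S | gamma_sp_set S) \max_(Ss | private_family S Ss)
    \max_(X : {set T} | (X \subset S) &&
                        (nbhs X :&: (~: S :|: Ss) == set0)) #|X|.

End SuperDomination.

Definition cartesian_product (T U : finType) (eG : rel T) (eH : rel U) :
    rel (T * U) :=
  fun p q => (p.1 == q.1) && eH p.2 q.2 || eG p.1 q.1 && (p.2 == q.2).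

(* Main.v *)
(* If [D] is super dominating, then choosing for each [u] outside [D] a vertex
   of [D] whose only neighbour outside [D] is [u] gives an injection of the
   complement of [D] into [D]; hence the lower bound. For the upper bound, let
   [S], [Ss], [X] be as in the definition of [lambda eG] and let [D] be super
   dominating in [H]. Then [S x V(H)] with [X x ~D] removed is super dominating
   in the product: [(u, h)] with [u] outside [S] is served by [(v, h)] with
   [v] in [Ss], and [(x, h)] with [x] in [X] and [h] outside [D] is served by
   [(x, k)] with [k] in [D]. The condition on [X] prevents the two parts of
   the complement from interfering. *)
Require Import Defs.
From mathcomp Require Import all_boot all_order all_algebra.
From mathcomp Require Import zify.

Section SuperDominationNumber.
Set Implicit Arguments.
Unset Strict Implicit.
Variables (T : finType) (e : rel T).

Lemma gamma_sp_le (D : {set T}) : super_dominating e D -> gamma_sp e <= #|D|.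
Proof.
rewrite /gamma_sp => sdD.
by case: arg_minnP => [|D0 _]; [exact: super_dominatingT | apply].
Qed.

Lemma gamma_sp_witness :
  exists2 D, super_dominating e D & #|D| = gamma_sp e.
Proof.
rewrite /gamma_sp; case: arg_minnP => [|D sdD _]; first exact: super_dominatingT.
by exists D.
Qed.

Lemma super_dominating_card_setC (D : {set T}) :
  super_dominating e D -> #|~: D| <= #|D|.
Proof.
move=> /forall_inP sdD.
(* On [~: D] the pick succeeds, so the default [u] is never returned there. *)
pose f u := odflt u [pick v in D | nbh e v :&: ~: D == [set u]].
have fP u : u \in ~: D -> f u \in D /\ nbh e (f u) :&: ~: D = [set u].
  move=> /sdD /exists_inP[v vD vu]; rewrite /f.
  by case: pickP => [w /andP[wD /eqP]|/(_ v)] //=; rewrite vD vu.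
have inj_f : {in ~: D &, injective f}.
  move=> u w /fP[_ fu] /fP[_ fw] fuw.
  by apply: set1_inj; rewrite -fu -fw fuw.
rewrite -(card_in_imset inj_f); apply/subset_leq_card/subsetP => v.
by case/imsetP=> u /fP[fuD _] ->.
Qed.

Lemma uphalf_card_le_gamma_sp : uphalf #|T| <= gamma_sp e.
Proof.
have [D /super_dominating_card_setC leD <-] := gamma_sp_witness.
by have := cardsC D; lia.
Qed.

End SuperDominationNumber.

Section CartesianProduct.
Set Implicit Arguments.
Unset Strict Implicit.
Variables (T U : finType) (eG : rel T) (eH : rel U).
Hypothesis symG : symmetric eG.

Lemma super_dominating_cartesian_product (S Ss X : {set T}) (D : {set U}) :
    Ss \subset S ->
    [forall u in ~: S, exists v in Ss, nbh eG v :&: ~: S == [set u]] ->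
    X \subset S -> nbhs eG X :&: (~: S :|: Ss) = set0 ->
    super_dominating eH D ->
  super_dominating (cartesian_product eG eH) (setX S setT :\: setX X (~: D)).
Proof.
move=> /subsetP sSs /forall_inP priv /subsetP sXS nX /forall_inP sdD.
(* Usable form of the condition on [X]: its neighbours stay in [S] and avoid [Ss]. *)
have XN x w : x \in X -> eG x w -> w \in S /\ w \notin Ss.
  move=> xX exw; have wX : w \in nbhs eG X.
    by apply/bigcupP; exists x; rewrite ?inE.
  have := in_set0 w; rewrite -nX !inE wX /= => /negbT.
  by rewrite negb_or negbK => /andP.
apply/forall_inP=> -[u h]; rewrite !inE /= andbT negb_and !negbK.
have [uS /= | uS _] := boolP (u \in S).
  rewrite orbF => /andP[uX hD].
  have /exists_inP[k kD /eqP kh] : [exists k in D, nbh eH k :&: ~: D == [set h]].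
    by apply: sdD; rewrite inE.
  apply/exists_inP; exists (u, k); first by rewrite !inE /= kD uS andbF.
  apply/eqP/setP=> -[w l]; move/setP/(_ l): kh.
  rewrite !inE /cartesian_product /= xpair_eqE => kl.
  have [<-{w}|_] /= := eqVneq u w.
    rewrite uS uX /= !andbT negbK.
    have [<-{l kl}|_] := eqVneq k l; last by rewrite andbF orbF -kl.
    by rewrite kD !andbF; apply/esym; apply: contraNF hD => /eqP <-.
  (* A neighbour [(w, k)] along [eG] is in the product set: [w] is in [S] and [k] in [D]. *)
  apply/negbTE/negP=> /andP[/andP[euw /eqP <-]].
  by rewrite kD !andbF andbT /= (XN _ _ uX euw).1.
have /exists_inP[v vSs /eqP vu] : [exists v in Ss, nbh eG v :&: ~: S == [set u]].
  by apply: priv; rewrite inE.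
have evu : eG v u by have := set11 u; rewrite -vu !inE => /andP[].
(* So the whole fibre over [v] lies in the product set, and edges of [eH] at [(v, h)] never leave
   it. *)
have vX : v \notin X.
  by apply: contra uS => /XN /(_ evu) [].
have vS := sSs _ vSs.
apply/exists_inP; exists (v, h); first by rewrite !inE /= (negPf vX) vS.
apply/eqP/setP=> -[w l]; move/setP/(_ w): vu.
rewrite !inE /cartesian_product /= xpair_eqE => vw.
have [<-{w vw}|_] /= := eqVneq v w.
  rewrite vS (negPf vX) /= !andbF; apply/esym/negbTE.
  by apply: contra uS => /andP[/eqP <-].
rewrite -vw [l == h]eq_sym; case: (h == l); last by rewrite !andbF.
rewrite !andbT; have [evw /= | //] := boolP (eG v w).
(* By symmetry [v] in [Ss] would be a neighbour of [w], which [XN] forbids for [w] in [X]. *)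
have wX : w \notin X.
  by apply: contraL vSs => wX; have [] := XN w v wX; rewrite // symG.
by rewrite (negPf wX).
Qed.

Lemma gamma_sp_cartesian_product_le (S Ss X : {set T}) :
    Ss \subset S ->
    [forall u in ~: S, exists v in Ss, nbh eG v :&: ~: S == [set u]] ->
    X \subset S -> nbhs eG X :&: (~: S :|: Ss) = set0 ->
  gamma_sp (cartesian_product eG eH) + #|X| * (#|U| - gamma_sp eH)
    <= #|U| * #|S|.
Proof.
move=> sSs priv sXS nX; have [D sdD <-] := gamma_sp_witness eH.
have /gamma_sp_le :=
  super_dominating_cartesian_product sSs priv sXS nX sdD.
rewrite -(leq_add2r (#|X| * (#|U| - #|D|))) => /leq_trans; apply.
have sub : setX X (~: D) \subset setX S setT by rewrite setXS ?subsetT.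
have -> : #|X| * (#|U| - #|D|) = #|setX X (~: D)|.
  by rewrite cardsX [#|~: D|]cardsCs setCK.
rewrite cardsD (setIidPr sub) subnK ?subset_leq_card //.
by rewrite cardsX cardsT mulnC.
Qed.

Lemma gamma_sp_cartesian_product_lambda :
  gamma_sp (cartesian_product eG eH) + lambda eG * (#|U| - gamma_sp eH)
    <= #|U| * gamma_sp eG.
Proof.
(* A maximum of two numbers is one of them, so [K] passes through the nested maxima of [lambda];
   [K 0] covers empty ranges. *)
pose K m := gamma_sp (cartesian_product eG eH) + m * (#|U| - gamma_sp eH)
    <= #|U| * gamma_sp eG.
have K0 : K 0.
  have [S sdS cardS] := gamma_sp_witness eG.
  have nX0 : nbhs eG set0 :&: (~: S :|: S) = set0.
    by rewrite /nbhs big_set0 set0I.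
  (* With [Ss := S], the private-neighbour condition is super domination itself. *)
  have := gamma_sp_cartesian_product_le (subxx S) sdS (sub0set S) nX0.
  by rewrite cards0 cardS.
have Kmax m p : K m -> K p -> K (maxn m p) by rewrite /maxn; case: ifP.
rewrite -/(K (lambda eG)) /lambda.
apply: (big_ind K) => // S /andP[_ /eqP cardS].
apply: (big_ind K) => // Ss /and3P[sSs _ priv].
apply: (big_ind K) => // X /andP[sXS /eqP nX].
by rewrite /K -cardS; apply: gamma_sp_cartesian_product_le nX.
Qed.

End CartesianProduct.

Theorem theorem20 (T U : finType) (eG : rel T) (eH : rel U)
    (symG : symmetric eG) (irrG : irreflexive eG)
    (symH : symmetric eH) (irrH : irreflexive eH)
    (n n' : nat) (cardG : #|T| = n) (cardH : #|U| = n')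
    (hn : 2 <= n) (hn' : 2 <= n') :
  uphalf (n * n') <= gamma_sp (cartesian_product eG eH) /\
  ((gamma_sp (cartesian_product eG eH))%:Z <=
     n'%:Z * (gamma_sp eG)%:Z
       - (lambda eG)%:Z * (n'%:Z - (gamma_sp eH)%:Z))%R.
Proof.
split; first by rewrite -cardG -cardH -card_prod uphalf_card_le_gamma_sp.
(* This makes the truncated difference in [nat] agree with the integer one. *)
have le_gH : gamma_sp eH <= n'.
  by rewrite -cardH -cardsT gamma_sp_le ?super_dominatingT.
have := gamma_sp_cartesian_product_lambda eH symG; rewrite cardH => le_gGH.
by rewrite subzn // -!PoszM; lia.
Qed.
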